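(* Let $X$ be a Tychonoff space which contains an infinite compact subset and let $Y$ be an infinite Tychonoff space containing a non-scattered compact subset. Then $C_p(X,C_k(Y)_w)$ contains a complemented copy of $(c_0)_p$.
   Context: $C_k(Y)$ is the space of continuous real-valued functions on $Y$ with the compact-open topology, and for a locally convex space $E$, $E_w$ denotes $E$ endowed with its weak topology $\sigma(E,E')$. $C_p(X,E)$ is the space of all continuous functions $X\to E$ with the pointwise topology (inherited from the product $E^X$). Tychonoff means completely regular and Hausdorff. A space is scattered if each of its nonempty subspaces has a (relatively) isolated point. $(c_0)_p=\{x\in\mathbb{R}^\omega: x(n)\to 0\}$ with the topology inherited from the product $\mathbb{R}^\omega$. A locally convex space $G$ contains a complemented copy of $F$ if there are closed linear subspaces $G_1,G_2$ of $G$ with $G=G_1\oplus G_2$ algebraically, $G_1$ linearly homeomorphic to $F$, and the natural projection of $G$ onto $G_1$ continuous. *)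

(* Defs.v *)
From HB Require Import structures.
From mathcomp Require Import all_boot all_order all_algebra.
From mathcomp Require Import all_classical all_reals all_analysis.

Set Implicit Arguments.
Unset Strict Implicit.
Unset Printing Implicit Defensive.

Import Order.TTheory GRing.Theory Num.Theory.
Import numFieldTopology.Exports.

Local Open Scope classical_set_scope.
Local Open Scope ring_scope.

Definition tychonoff_space (X : topologicalType) : Prop :=
  completely_regular_space X /\ hausdorff_space X.

(* [isolated A x] refers to the topology that [A] inherits from [X], so this is
   scatteredness of [K] as a subspace. *)
Definition scattered (X : topologicalType) (K : set X) : Prop :=
  forall A : set X, A `<=` K -> A !=set0 -> isolated A !=set0.

(* Pointwise vector space structure on the continuous functions [X -> E]. *)
Section continuous_lmodule.
Context (R : numDomainType) (X : topologicalType) (E : topologicalLmodType R).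
Implicit Types (f g h : continuousType X E) (a b : R).

Let zero_cts : continuous (fun _ : X => 0 : E).
Proof. by move=> x; exact: cvg_cst. Qed.

Let opp_cts f : continuous (fun x => - f x).
Proof.
move=> x; apply: (@continuous_comp _ _ _ f -%R); first exact: cts_fun.
exact: opp_continuous.
Qed.

Let add_cts f g : continuous (fun x => f x + g x).
Proof.
move=> x; apply: (@continuous_comp _ _ _ (fun x => (f x, g x))
  (fun z : E * E => z.1 + z.2)); last exact: add_continuous.
by apply: cvg_pair; exact: cts_fun.
Qed.

Let scale_cts a f : continuous (fun x => a *: f x).
Proof.
move=> x; apply: (@continuous_comp _ _ _ (fun x => (a : R^o, f x))
  (fun z : R^o * E => z.1 *: z.2)); last exact: scale_continuous.
by apply: (@cvg_pair _ _ _ _ (nbhs (a : R^o)));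
  [exact: cvg_cst|exact: cts_fun].
Qed.

Definition cts_zero : continuousType X E := mkcts zero_cts.
Definition cts_opp f : continuousType X E := mkcts (@opp_cts f).
Definition cts_add f g : continuousType X E := mkcts (@add_cts f g).
Definition cts_scale a f : continuousType X E := mkcts (@scale_cts a f).

Let cts_addA : associative cts_add.
Proof. by move=> f g h; apply/continuousEP => x; exact: addrA. Qed.

Let cts_addC : commutative cts_add.
Proof. by move=> f g; apply/continuousEP => x; exact: addrC. Qed.

Let cts_add0 : left_id cts_zero cts_add.
Proof. by move=> f; apply/continuousEP => x; exact: add0r. Qed.

Let cts_addN : left_inverse cts_zero cts_opp cts_add.
Proof. by move=> f; apply/continuousEP => x; exact: addNr. Qed.

HB.instance Definition _ := GRing.isZmodule.Build (continuousType X E)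
  cts_addA cts_addC cts_add0 cts_addN.

Let cts_scaleA a b f : cts_scale a (cts_scale b f) = cts_scale (a * b) f.
Proof. by apply/continuousEP => x; exact: scalerA. Qed.

Let cts_scale1 : left_id 1 cts_scale.
Proof. by move=> f; apply/continuousEP => x; exact: scale1r. Qed.

Let cts_scaleDr : right_distributive cts_scale +%R.
Proof. by move=> a f g; apply/continuousEP => x; exact: scalerDr. Qed.

Let cts_scaleDl f : {morph cts_scale^~ f : a b / a + b}.
Proof. by move=> a b; apply/continuousEP => x; exact: scalerDl. Qed.

HB.instance Definition _ := GRing.Zmodule_isLmodule.Build R
  (continuousType X E) cts_scaleA cts_scale1 cts_scaleDr cts_scaleDl.

End continuous_lmodule.

(* [C_p(X, E)]: the topology is the one inherited from the product [E^X]. *)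
Definition Cp (R : realType) (X : topologicalType)
  (E : topologicalLmodType R) : Type := continuousType X E.

HB.instance Definition _ (R : realType) (X : topologicalType)
    (E : topologicalLmodType R) :=
  GRing.Lmodule.copy (Cp X E) (continuousType X E).
HB.instance Definition _ (R : realType) (X : topologicalType)
    (E : topologicalLmodType R) :=
  Topological.copy (Cp X E)
    (initial_topology (fun f : continuousType X E => (f : X -> E) : {ptws X -> E})).

(* [C_k(Y)] *)
Definition Ck (R : realType) (Y : topologicalType) : Type :=
  continuousType Y R^o.

HB.instance Definition _ (R : realType) (Y : topologicalType) :=
  GRing.Lmodule.copy (Ck R Y) (continuousType Y R^o).
HB.instance Definition _ (R : realType) (Y : topologicalType) :=
  Topological.copy (Ck R Y)
    (initial_topology (fun f : continuousType Y R^o =>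
      (f : Y -> R^o) : {compact-open, Y -> R^o})).

Section weak_topology.
Context (R : realType) (E : preTopologicalLmodType R).

Definition continuous_dual : Type := {phi : {linear E -> R^o} | continuous phi}.

(* [E_w], that is, [E] with [sigma(E, E')] *)
Definition weak : Type := E.

HB.instance Definition _ := GRing.Lmodule.on weak.
HB.instance Definition _ := Topological.copy weak
  (sup_topology (fun phi : continuous_dual =>
    Topological.class (initial_topology (sval phi : E -> R^o)))).

Let cvg_weak (F : set_system weak) (e : weak) : Filter F ->
  (forall phi : continuous_dual, sval phi z @[z --> F] --> sval phi e) -> F --> e.
Proof.
move=> FF cvF; apply/cvg_sup => phi A /=.
rewrite (@nbhsE (initial_topology (sval phi : E -> R^o))).
move=> -[_ [[B oB <-] Be] sBA]; rewrite nbhs_filterE; apply: filterS sBA _.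
by apply: (cvF phi); exact: open_nbhs_nbhs.
Qed.

Let dual_continuous (phi : continuous_dual) : continuous (sval phi : weak -> R^o).
Proof.
move=> e; have /cvg_sup/(_ phi) : (nbhs e) --> (e : weak) by exact: cvg_id.
move=> cve A nA; apply: cve.
exact: (@initial_continuous _ _ (sval phi : E -> R^o) e A nA).
Qed.

Let weak_add_continuous : continuous (fun z : weak * weak => z.1 + z.2).
Proof.
move=> z; apply: cvg_weak => phi /=.
have dualD (x y : weak) : sval phi (x + y) = sval phi x + sval phi y.
  exact: (raddfD (sval phi)).
rewrite dualD -fmap_comp /comp; under eq_fun do rewrite dualD.
apply: (@continuous_comp _ _ _
  (fun z : weak * weak => (sval phi z.1 : R^o, sval phi z.2 : R^o))
  (fun z : R^o * R^o => z.1 + z.2)); last exact: add_continuous.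
have c1 : sval phi w.1 @[w --> z] --> (sval phi z.1 : R^o).
  exact: (cvg_comp fst (sval phi) cvg_fst (@dual_continuous phi z.1)).
have c2 : sval phi w.2 @[w --> z] --> (sval phi z.2 : R^o).
  exact: (cvg_comp snd (sval phi) cvg_snd (@dual_continuous phi z.2)).
exact: (cvg_pair c1 c2).
Qed.

Let weak_scale_continuous : continuous (fun z : R^o * weak => z.1 *: z.2).
Proof.
move=> z; apply: cvg_weak => phi /=.
have dualZ a (x : weak) : sval phi (a *: x) = a *: sval phi x.
  exact: (linearZZ (sval phi)).
rewrite dualZ -fmap_comp /comp; under eq_fun do rewrite dualZ.
apply: (@continuous_comp _ _ _
  (fun z : R^o * weak => (z.1, sval phi z.2 : R^o))
  (fun z : R^o * R^o => z.1 *: z.2)); last exact: scale_continuous.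
have c2 : sval phi w.2 @[w --> z] --> (sval phi z.2 : R^o).
  exact: (cvg_comp snd (sval phi) cvg_snd (@dual_continuous phi z.2)).
have c1 : w.1 @[w --> z] --> (z.1 : R^o) by exact: cvg_fst.
exact: (cvg_pair c1 c2).
Qed.

HB.instance Definition _ :=
  PreTopologicalNmodule_isTopologicalNmodule.Build weak weak_add_continuous.
HB.instance Definition _ :=
  TopologicalNmodule_isTopologicalLmodule.Build R weak weak_scale_continuous.

End weak_topology.

Section c0.
Context (R : realType).

Definition c0_pred : {pred nat -> R^o} :=
  [pred x : nat -> R^o | `[< x @ \oo --> (0 : R^o) >]].

Let c0_submod_closed : submod_closed c0_pred.
Proof.
split=> [|a x y /asboolP cx /asboolP cy]; apply/asboolP; first exact: cvg_cst.
have : (a *: x + y) @ \oo --> a *: (0 : R^o) + (0 : R^o).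
  by apply: cvgD => //; exact: (@cvgZl_tmp R R^o _ _ _ a x 0 cx).
by rewrite scaler0 addr0.
Qed.

HB.instance Definition _ :=
  GRing.isSubmodClosed.Build R (nat -> R^o) c0_pred c0_submod_closed.

(* [(c_0)_p] *)
Definition c0p : Type := {x : nat -> R^o | x \in c0_pred}.

HB.instance Definition _ := SubChoice.on c0p.
HB.instance Definition _ := [SubChoice_isSubLmodule of c0p by <:].
HB.instance Definition _ := Topological.copy c0p
  (initial_topology (fun x : c0p => (val x : {ptws nat -> R^o}))).

End c0.

Definition linear_subspace (R : pzRingType) (G : lmodType R) (A : set G) : Prop :=
  submod_closed [in A].

(* [T] is a linear homeomorphism of [F] onto [A] with the subspace topology, of
   inverse [S]. *)
Definition linearly_homeomorphic (R : realType)
    (F G : preTopologicalLmodType R) (A : set G) : Prop :=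
  exists (T : {linear F -> G}) (S : G -> F),
    [/\ range T = A, cancel T S, continuous T & {within A, continuous S}].

(* Only the vector space structure and the topology of [G] and [F] matter, so
   local convexity is not part of the types. In the last clause, [P] is the
   natural projection of [G1 + G2] onto [G1], composed with the inclusion. *)
Definition contains_complemented_copy (R : realType)
    (G F : preTopologicalLmodType R) : Prop :=
  exists G1 G2 : set G,
    [/\ linear_subspace G1 /\ closed G1,
        linear_subspace G2 /\ closed G2,
        (forall g, exists g1 g2, [/\ G1 g1, G2 g2 & g = g1 + g2]) /\
          G1 `&` G2 = [set 0],
        linearly_homeomorphic F G1
      & exists2 P : G -> G,
          (forall g1 g2, G1 g1 -> G2 g2 -> P (g1 + g2) = g1) & continuous P].

(* Main.v *)
From HB Require Import structures.
Require Import Defs.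
From mathcomp Require Import all_boot all_order all_algebra.
From mathcomp Require Import all_classical all_reals all_analysis.
From mathcomp Require Import ring lra.

Set Implicit Arguments.
Unset Strict Implicit.
Unset Printing Implicit Defensive.

Import Order.TTheory GRing.Theory Num.Theory.
Import numFieldNormedType.Exports.

Local Open Scope classical_set_scope.
Local Open Scope ring_scope.

(** Write E for C_k(Y) with its weak topology and G for C_p(X, E).  A copy of
(c_0)_p is complemented in G as soon as there are continuous linear maps
T : (c_0)_p -> G and S : G -> (c_0)_p with S o T = id: then G is the direct sum
of the range of T and the kernel of S, with projection T o S.

The space X supplies points x_n in an infinite compact set K and bumps b_n on X
with disjoint supports and b_n(x_n) = 1.  The space Y supplies continuous
functions e_n with values in [-1, 1] and a positive functional I on C(Y),
carried by a compact set L, for which they are orthonormal: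
I(e_i e_j) = delta_ij.  With these,
  T(a)(z) = sum_n a_n b_n(z) e_n   and   S(g)_n = I(e_n g(x_n)).
At each z at most one term of the sum survives, so T(a)(z) depends on a single
coordinate of a and T is continuous for the pointwise topologies; T(a) is
weakly continuous because a_n phi(e_n) -> 0 for each functional phi
([disjoint_series_continuous]).  The whole difficulty is that S takes its values
in c_0.

The functional I plays the role of a probability measure, and the e_n that of a
Rademacher sequence for it ([rademacher_mean]).  As L is chosen not scattered, it
contains a nonempty set A without isolated points.  There are functions e_n such
that every finite pattern of signs is attained at a point of A, because each
point of A can be split into two distinct ones ([rademacher_system]).  The functional I is a limit along an ultrafilter of the
averages over the 2^m points that realise the patterns of length m.

That I(e_n g(x_n)) -> 0 is an instance of the Dunford-Pettis property of C(L)
([orthonormal_weak_cvg0]).  Suppose it fails; pass to a subsequence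
on which these numbers stay away from 0.  The set g(K) is compact for pointwise
convergence on L, so by the Eberlein-Smulian argument a further subsequence of
g(x_n) converges pointwise on L to g(p) for some p in K ([eberlein]).  It is
uniformly bounded on L by a gliding hump argument
([weakly_compact_bounded]), so dominated convergence gives
I(|g(x_n) - g(p)|) -> 0 ([dominated_cvg0]), while I(e_n g(p)) -> 0 by Bessel's
inequality ([bessel_cvg0]).  Since |e_n| <= 1, this is a contradiction.

Dominated convergence for I is proved on continuous functions only, by Dini's
theorem, which avoids representing I by a measure. *)

(** * Functionals on spaces of continuous functions *)

Lemma compact_norm_bounded (R : realType) (X : topologicalType) (f : X -> R)
    (K : set X) : compact K -> continuous f ->
  exists2 e : R, 0 < e & forall x, K x -> `|f x| <= e.
Proof.
move=> cK cf; have /ex_strict_bound_gt0[k k0 hk] : bounded_set (f @` K).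
  exact/compact_bounded/continuous_compact/cK/continuous_subspaceT.
by exists k => // x Kx; apply/ltW/hk; exists x.
Qed.

Lemma cvg_initial_topology (S : choiceType) (T : topologicalType) (f : S -> T)
    (I : Type) (F : set_system I) (FF : Filter F) (u : I -> S) (x : S) :
  f (u i) @[i --> F] --> f x -> u i @[i --> F] --> (x : initial_topology f).
Proof.
move=> cu A; rewrite (@nbhsE (initial_topology f)).
move=> -[_ [[B oB <-] Bx] sBA]; apply: filterS sBA _.
by apply: cu; exact: open_nbhs_nbhs.
Qed.

Section functionals.
Context (R : realType) (Y : topologicalType).
Implicit Types (f g h : Ck R Y) (L : set Y).

Lemma CkP f g : (forall y, f y = g y) -> f = g.
Proof. by move=> fg; apply/continuousEP. Qed.

Lemma CkD f g y : (f + g) y = (f y : R) + (g y : R) :> R. Proof. by []. Qed.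
Lemma CkN f y : (- f) y = - (f y : R) :> R. Proof. by []. Qed.
Lemma CkZ (a : R) f y : (a *: f) y = a * (f y : R) :> R. Proof. by []. Qed.
Lemma Ck0 y : (0 : Ck R Y) y = 0 :> R. Proof. by []. Qed.

Lemma Ck_cvg (T : Type) (F : set_system T) (FF : Filter F)
    (u : T -> Ck R Y) h :
  (forall L, compact L -> forall e : R, 0 < e ->
    \forall t \near F, forall y, L y -> `|h y - u t y| < e) ->
  u t @[t --> F] --> h.
Proof.
move=> cu; apply: cvg_initial_topology.
have ch : continuous (h : Y -> R^o) by exact: cts_fun.
apply/(compact_open_fam_compactP ch)/fam_cvgP => L cL P /uniform_nbhs.
rewrite -entourage_ballE => -[E [[e /= e0 sE] sP]].
apply: filterS (cu L cL e e0) => t ut; apply: sP => y Ly.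
by apply: sE; exact: ut.
Qed.

(** With [Ck_cvg], this describes the compact-open topology of [Ck R Y] by
uniform approximation on compact sets. *)
Lemma Ck_near h L (e : R) : compact L -> 0 < e ->
  \forall z \near nbhs h, forall y, L y -> `|h y - (z : Ck R Y) y| < e.
Proof.
move=> cL e0.
pose i (f : continuousType Y R^o) : {compact-open, Y -> R^o} := f.
have ih : {compact-open, i @ (h : initial_topology i) --> i h}.
  exact: (@initial_continuous _ _ i h).
have ch : continuous (h : Y -> R^o) by exact: cts_fun.
have FF := @fmap_filter _ _ i _ (@nbhs_filter (initial_topology i) h).
have := (fam_cvgP _ _ FF).1 ((compact_open_fam_compactP ch FF).1 ih) L cL.
pose B := [set g : Y -> R^o | forall y, L y -> ball (h y) e (g y)].
suff nB : nbhs (h : {uniform` L -> R^o}) B by move=> /(_ B nB).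
apply/uniform_nbhs; exists [set xy | ball xy.1 e xy.2]; split => //.
by rewrite -entourage_ballE; exists e.
Qed.

Lemma dual_of_bound (phi : {linear Ck R Y -> R^o}) L (C : R) : compact L ->
  (forall h e, (forall y, L y -> `|h y| <= e) -> `|phi h| <= C * e) ->
  continuous (phi : Ck R Y -> R^o).
Proof.
move=> cL bphi h; have hF := @nbhs_filter (Ck R Y) h; apply/cvgrPdist_le => e e0.
pose d : R := e / (`|C| + 1).
have C0 : 0 < `|C| + 1 by rewrite ltr_wpDl.
have d0 : 0 < d by rewrite divr_gt0.
near=> z; rewrite -raddfB /=.
apply: (le_trans (bphi (h - z) d _)).
  move=> y Ly; apply: ltW.
  move: y Ly; near: z; exact: Ck_near.
rewrite /d mulrCA ler_piMr ?(ltW e0)// ler_pdivrMr// mul1r.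
by rewrite (le_trans (ler_norm _))// lerDl.
Unshelve. all: by end_near. Qed.

Lemma Ck_bounded h L : compact L ->
  exists2 e : R, 0 < e & forall y, L y -> `|h y| <= e.
Proof. by move=> cL; exact: (compact_norm_bounded cL (@cts_fun _ _ h)). Qed.

(** A bounded sequence of functionals has a limit along an ultrafilter, which is
again linear and bounded.  Only the transfer of eventual upper bounds is stated:
applied to [h] and to [- h], it transfers lower bounds and eventual values as
well. *)
Lemma limit_functional L (C : R) (S : nat -> Ck R Y -> R) : compact L ->
  (forall n a f g, S n (a *: f + g) = a * S n f + S n g) ->
  (forall n h e, (forall y, L y -> `|h y| <= e) -> `|S n h| <= C * e) ->
  exists phi : continuous_dual (Ck R Y), forall h N a,
    (forall n, (N <= n)%N -> S n h <= a) -> sval phi h <= a.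
Proof.
move=> cL linS bS.
have [U [ultU leU]] := @ultraFilterLemma _ (@nbhs nat _ \oo) _.
have limS h : exists l : R, S n h @[n --> U] --> l.
  have [e e0 he] := Ck_bounded h cL.
  have [|l [_ cl]] := @segment_compact R (- (C * e)) (C * e) (S n h @[n --> U]) _.
    apply: (@filterE _ U) => n /=.
    by rewrite in_itv/= -ler_norml; exact: bS.
  exists l => A nA.
  have [//|UA] := in_ultra_setVsetC ((S ^~ h) @^-1` A) ultU.
  by have [z [nAz /nAz]] := cl (~` A) A UA nA.
have [phi phiP] := choice limS.
have lin_phi : linear phi.
  move=> a f g; apply: (cvg_unique (@norm_hausdorff _ R) (phiP _)) => /=.
  rewrite (_ : S ^~ _ = (fun n => a * S n f + S n g)); last first.
    by apply/funext => n; exact: linS.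
  by apply: cvgD; [exact: cvgMr (phiP f)|exact: phiP].
pose mphi := GRing.isLinear.Build R (Ck R Y) R^o *:%R phi lin_phi.
pose phiL : {linear Ck R Y -> R^o} := HB.pack phi mphi.
have cphi : continuous (phiL : Ck R Y -> R^o).
  apply: (@dual_of_bound phiL L C) => // h e he /=.
  apply: (@cvgr_to_le _ U _ R (fun n => `|S n h|)).
    by apply: cvg_norm; exact: phiP.
  by apply: filterE => n; exact: bS.
exists (exist _ phiL cphi) => h N a ha /=.
apply: (@cvgr_to_le _ U _ R _ _ _ (phiP h)).
by apply: leU; exists N => // n /= Nn; exact: ha.
Qed.

End functionals.

(** * Positive functionals: Bessel's inequality and dominated convergence *)

Section positive_functionals.
Context (R : realType) (Y : topologicalType).
Implicit Types (f g h : Ck R Y).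

Lemma Ck_cts f : continuous (f : Y -> R).
Proof. exact: cts_fun. Qed.

Let mul_cts f g : continuous ((fun y => f y * g y) : Y -> R^o).
Proof. by move=> y; apply: cvgM; exact: Ck_cts. Qed.

Let max_cts f g : continuous ((fun y => Num.max (f y) (g y)) : Y -> R^o).
Proof. by move=> y; apply: continuous_max; exact: Ck_cts. Qed.

Let min_cts f g : continuous ((fun y => Num.min (f y) (g y)) : Y -> R^o).
Proof. by move=> y; apply: continuous_min; exact: Ck_cts. Qed.

Let abs_cts f : continuous ((fun y => `|f y|) : Y -> R^o).
Proof. by move=> y; apply: cvg_norm; exact: Ck_cts. Qed.

Let one_cts : continuous ((fun=> 1) : Y -> R^o).
Proof. by move=> y; exact: cvg_cst. Qed.

Definition Ck_mul f g : Ck R Y := mkcts (@mul_cts f g).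
Definition Ck_max f g : Ck R Y := mkcts (@max_cts f g).
Definition Ck_min f g : Ck R Y := mkcts (@min_cts f g).
Definition Ck_abs f : Ck R Y := mkcts (@abs_cts f).
Definition Ck_one : Ck R Y := mkcts one_cts.

Lemma Ck_mulE f g y : Ck_mul f g y = (f y : R) * (g y : R) :> R. Proof. by []. Qed.
Lemma Ck_maxE f g y : Ck_max f g y = Num.max (f y : R) (g y : R) :> R. Proof. by []. Qed.
Lemma Ck_minE f g y : Ck_min f g y = Num.min (f y : R) (g y : R) :> R. Proof. by []. Qed.
Lemma Ck_absE f y : Ck_abs f y = `|(f y : R)| :> R. Proof. by []. Qed.
Lemma Ck_oneE y : Ck_one y = 1 :> R. Proof. by []. Qed.

Lemma Ck_mulDr f g h : Ck_mul f (g + h) = Ck_mul f g + Ck_mul f h.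
Proof. by apply: CkP => y; exact: mulrDr. Qed.

Lemma Ck_mulZr f (a : R) g : Ck_mul f (a *: g) = a *: Ck_mul f g.
Proof. by apply: CkP => y; exact: mulrCA. Qed.

Variables (L : set Y) (I : {linear Ck R Y -> R^o}).
Hypothesis Ipos : forall f, (forall y, L y -> 0 <= f y) -> 0 <= I f.
Hypothesis I1 : I Ck_one = 1.

Let ID f g : I (f + g) = (I f : R) + (I g : R) :> R.
Proof. exact: (linearD I). Qed.

Let IB f g : I (f - g) = (I f : R) - (I g : R) :> R.
Proof. exact: (linearB I). Qed.

Let IZ (a : R) f : I (a *: f) = a * (I f : R) :> R.
Proof. exact: (linearZ_LR I). Qed.

Lemma positive_le f g : (forall y, L y -> f y <= g y) -> I f <= I g.
Proof.
move=> fg; rewrite -subr_ge0 -raddfB; apply: Ipos => y Ly.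
by rewrite CkD CkN subr_ge0; exact: fg.
Qed.

Lemma positive_le_cst f (c : R) : (forall y, L y -> f y <= c) -> I f <= c.
Proof.
move=> fc; have -> : c = I (c *: Ck_one) by rewrite linearZ I1 [RHS]mulr1.
by apply: positive_le => y Ly; rewrite CkZ Ck_oneE mulr1; exact: fc.
Qed.

Lemma positive_abs f : `|I f| <= I (Ck_abs f).
Proof.
rewrite ler_norml lerNl -raddfN; apply/andP; split; apply: positive_le => y _.
  by rewrite CkN Ck_absE -normrN ler_norm.
exact: ler_norm.
Qed.

Section bessel.
Variables (e : nat -> Ck R Y) (g : Ck R Y).
Hypothesis orth : forall i j, I (Ck_mul (e i) (e j)) = (i == j)%:R.

Let c i : R := I (Ck_mul (e i) g).

(** What remains of [g] when its orthogonal projection on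
[e 0, ..., e n.-1] is subtracted. *)
Fixpoint bessel_rem n :=
  if n is m.+1 then bessel_rem m - c m *: e m else g.

Let remE n j : (n <= j)%N -> I (Ck_mul (e j) (bessel_rem n)) = c j.
Proof.
elim: n => [//|n ih] nj /=.
rewrite Ck_mulDr -scaleNr Ck_mulZr ID IZ ih ?(ltnW nj)//.
by rewrite orth gtn_eqF// mulr0 addr0.
Qed.

(** Pythagoras: each step removes [c n ^+ 2] from the square norm.  The right-hand
side is thus nonnegative, which is Bessel's inequality. *)
Let rem_sqr n :
  I (Ck_mul (bessel_rem n) (bessel_rem n)) =
  I (Ck_mul g g) - \sum_(0 <= i < n) c i ^+ 2.
Proof.
elim: n => [|n ih]; first by rewrite big_geq// subr0.
rewrite big_nat_recr//= opprD addrA -ih.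
have -> : Ck_mul (bessel_rem n - c n *: e n) (bessel_rem n - c n *: e n) =
    Ck_mul (bessel_rem n) (bessel_rem n)
    - (2 * c n) *: Ck_mul (e n) (bessel_rem n)
    + (c n ^+ 2) *: Ck_mul (e n) (e n).
  have expand (r a b : R) :
      (r - a * b) * (r - a * b) = r * r - 2 * a * (b * r) + a ^+ 2 * (b * b).
    by ring.
  by apply: CkP => y; exact: expand.
rewrite ID IB !IZ remE// orth eqxx.
have simp (r a : R) : r - 2 * a * a + a ^+ 2 * 1 = r - a ^+ 2 by ring.
exact: simp.
Qed.

Lemma bessel_cvg0 : I (Ck_mul (e n) g) @[n --> \oo] --> (0 : R).
Proof.
have le_g n : \sum_(0 <= i < n) c i ^+ 2 <= I (Ck_mul g g).
  rewrite -subr_ge0 -rem_sqr; apply: Ipos => y _; exact: sqr_ge0.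
have c2 : c n ^+ 2 @[n --> \oo] --> (0 : R).
  apply: cvg_series_cvg_0; apply: nondecreasing_is_cvgn.
    apply/nondecreasing_seqP => n; rewrite /series/= big_nat_recr//=.
    by rewrite lerDl sqr_ge0.
  by exists (I (Ck_mul g g)) => _ [n _ <-]; exact: le_g.
apply/cvgr0Pnorm_lt => d d0.
near=> n; rewrite -(@ltr_pXn2r _ 2)// ?nnegrE// ?ltW// -normrX.
by near: n; apply: cvgr0_norm_lt => //; exact: exprn_gt0.
Unshelve. all: by end_near. Qed.

End bessel.

Section dominated_convergence.
Variables (u : nat -> Ck R Y) (M : R).
Hypothesis cL : compact L.
Hypothesis u_ge0 : forall k y, L y -> 0 <= u k y.
Hypothesis u_le : forall k y, L y -> u k y <= M.
Hypothesis u_cvg : forall y, L y -> u k y @[k --> \oo] --> (0 : R).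

(** This is [g <= sup_(k >= n) u k] on [L].  The supremum is in general not
continuous, so it is only used through its upper bounds. *)
Definition below_tail n g := forall y, L y -> forall c : R,
  (forall k, (n <= k)%N -> u k y <= c) -> g y <= c.

Let A n : set R := [set I g | g in below_tail n].
Let s n := sup (A n).

Let below_tailS n g : below_tail n.+1 g -> below_tail n g.
Proof.
by move=> ng y Ly c hc; apply: ng => // k nk; apply: hc; exact: ltnW.
Qed.

Let below_tail_u n : below_tail n (u n).
Proof. by move=> y Ly c; exact. Qed.

Let supA n : has_sup (A n).
Proof.
split; first by exists (I (u n)); exists (u n).
exists M => _ [g ng <-]; apply: positive_le_cst => y Ly.
by apply: ng => // k _; exact: u_le.
Qed.

Let le_s n g : below_tail n g -> I g <= s n.
Proof. by move=> ng; apply: sup_upper_bound; [exact: supA|exists g]. Qed.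

(** Let [s n] be the supremum of [I g] over the continuous [g] below the tail
[sup_(k >= n) u k], a lower integral of that tail.  Choose nearly optimal [g n]
and let [G n] be the minimum of [g 0, ..., g n].  By Dini's theorem
[G n] eventually lies below a given positive constant on all of [L], and then so
does [I (G n)].  Passing from [g n]
to [G n] costs little, because the maximum of [g n.+1] and [G n] is still below
the [n]-th tail and [min + max] is the sum.  So [s n], hence [I (u n)], is
small. *)
Lemma dominated_cvg0 : I (u n) @[n --> \oo] --> (0 : R).
Proof.
apply/cvgr0Pnorm_le => eps eps0.
pose d : R := eps / 2.
have d0 : 0 < d by rewrite divr_gt0.
have /choice[g gP] n : exists g, below_tail n g /\ s n - d * 2^-1 ^+ n.+1 <= I g.
  have [|_ [g ng <-] /ltW ge] := @sup_adherent _ (A n) (d * 2^-1 ^+ n.+1) _ (supA n).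
    by rewrite mulr_gt0// exprn_gt0.
  by exists g.
pose G := fix G n := if n is m.+1 then Ck_min (g n) (G m) else g 0%N.
have G_below n : below_tail n (G n).
  case: n => [|n]; first exact: (gP _).1.
  move=> y Ly c hc /=; rewrite Ck_minE ge_min.
  by rewrite ((gP n.+1).1 y Ly c hc).
(* The errors [d / 2 ^+ i.+1] of the choices of [g i], for [i <= n], add up. *)
have G_ge n : s n - d * (1 - 2^-1 ^+ n.+1) <= I (G n).
  elim: n => [|n ih].
    by apply: le_trans (gP 0%N).2; rewrite lerD2l lerN2 ler_pM2l// expr1; lra.
  have minmax : I (G n.+1) = I (g n.+1) + I (G n) - I (Ck_max (g n.+1) (G n)) :> R.
    rewrite -ID -IB; congr (I _); apply: CkP => y.
    rewrite CkD CkN CkD Ck_minE Ck_maxE.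
    by case: leP => _; [rewrite addrK|rewrite addrAC subrr add0r].
  have le_max : I (Ck_max (g n.+1) (G n)) <= s n.
    apply: le_s => y Ly c hc; rewrite Ck_maxE ge_max.
    rewrite (below_tailS (gP n.+1).1 Ly hc)//.
    by rewrite (G_below n y Ly c hc).
  have := (gP n.+1).2; rewrite minmax; move: ih le_max.
  rewrite [_ ^+ n.+2]exprS => ih le_max ge_g; lra.
have G_decr N n y : (N <= n)%N -> G n y <= G N y.
  move=> /subnK <-; elim: (n - N)%N => [//|k ih].
  by rewrite addSn /= Ck_minE ge_min ih orbT.
(* Dini: [G] decreases, so its pointwise smallness is uniform on compact [L]. *)
have G_small : \forall n \near \oo, forall y, L y -> G n y <= d.
  have nc : near_covering L by apply/compact_near_coveringP.
  apply: nc => y Ly.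
  have [N _ hN] : \forall k \near \oo, `|u k y : R| <= d / 2.
    by apply: cvgr0_norm_le; [exact: u_cvg|rewrite divr_gt0].
  have {}hN k : (N <= k)%N -> u k y <= d / 2.
    by move=> /hN; apply: le_trans; exact: ler_norm.
  have GNy : G N y < d.
    apply: (@le_lt_trans _ _ (d / 2)); first exact: G_below.
    by rewrite ltr_pdivrMr// ltr_pMr// ltr1n.
  exists ([set y' | G N y' < d], [set n | (N <= n)%N]).
    split; last by exists N.
    by have /cvgr_lt := @Ck_cts (G N) y; apply.
  move=> [y' n] [/= GN Nn]; apply: le_trans (ltW GN); exact: G_decr.
near=> n.
have In0 : 0 <= I (u n) by apply: Ipos => y; exact: u_ge0.
rewrite ger0_norm//; apply: (le_trans (le_s (@below_tail_u n))).
have : I (G n) <= d.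
  by apply: positive_le_cst; near: n.
move=> /(le_trans (G_ge n)); rewrite lerBlDr => /le_trans; apply.
have : 0 <= 2^-1 ^+ n.+1 :> R by rewrite exprn_ge0.
rewrite /d; nra.
Unshelve. all: by end_near. Qed.

End dominated_convergence.

End positive_functionals.

(** * Sign functions on a set without isolated points *)

Section rademacher.
Context (R : realType) (Y : topologicalType).

Lemma Ck_sumE (I : Type) (r : seq I) (F : I -> Ck R Y) y :
  (\sum_(i <- r) F i) y = \sum_(i <- r) (F i y : R) :> R.
Proof.
by elim/big_rec2: _ => // i _ f _ <-.
Qed.

Lemma tychonoff_separation (p : Y) (B : set Y) :
  completely_regular_space Y -> closed B -> ~ B p ->
  exists u : Ck R Y, [/\ u p = 1, forall y, B y -> u y = 0
    & forall y, 0 <= u y <= 1].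
Proof.
move=> crY cB Bp; have sep := crY p B cB Bp.
pose v : Ck R Y := mkcts (@Urysohn_continuous Y R [set p] B).
exists (Ck_one R Y - v); split => [|y By|y].
- have v0 : v p = 0 by apply: (Urysohn_sub0 sep); exists p.
  by rewrite CkD CkN v0 subr0.
- have v1 : v y = 1 by apply: (Urysohn_sub1 sep); exists y.
  by rewrite CkD CkN v1 subrr.
have : `[0, 1]%classic (v y : R).
  by apply: (@Urysohn_range Y R [set p] B); exists y.
by rewrite /= in_itv/= CkD CkN Ck_oneE subr_ge0 gerBl andbC.
Qed.

(** Choose for each [p t] a nonnegative function that is [1] at [p t] and [0] at
every [q t'].  Their sum [w] is at least [1] at each [p t] and [0] at each
[q t'], so truncating [4 w - 2] to the interval from [- 1] to [1] makes it
constant near each of these points. *)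
Lemma finite_separation (T : finType) (p q : T -> Y) : tychonoff_space Y ->
  (forall t t', p t <> q t') ->
  exists e : Ck R Y, [/\ forall y, `|e y| <= 1,
    forall t, \forall z \near p t, e z = 1
    & forall t, \forall z \near q t, e z = - 1].
Proof.
move=> [crY hY] pq.
have cC : closed (range q).
  apply: accessible_finite_set_closed.1; first exact: hausdorff_accessible.
  by apply: finite_image; exact: finite_finset.
have /choice[u uP] t : exists u : Ck R Y, [/\ u (p t) = 1,
    forall y, range q y -> u y = 0 & forall y, 0 <= u y <= 1].
  by apply: tychonoff_separation => // -[t' _ /esym]; exact: pq.
pose w := \sum_t u t.
pose v := 4 *: w - 2 *: Ck_one R Y.
exists (Ck_max (- Ck_one R Y) (Ck_min (Ck_one R Y) v)).
have vE y : v y = 4 * (\sum_t (u t y : R)) - 2 :> R.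
  by rewrite CkD CkN !CkZ Ck_oneE mulr1 Ck_sumE.
split => [y|t|t].
- rewrite Ck_maxE Ck_minE CkN Ck_oneE.
  by rewrite ler_norml le_max lexx ge_max ge_min lexx/= andbT; lra.
- have /cvgr_gt : v z @[z --> p t] --> v (p t) by exact: Ck_cts.
  move=> /(_ 1) near1; have : 1 < v (p t).
    have [utp _ _] := uP t; rewrite vE (bigD1 t)//= utp.
    have : 0 <= \sum_(i | i != t) (u i (p t) : R).
      by apply: sumr_ge0 => i _; have [_ _ /(_ (p t))/andP[]] := uP i.
    by lra.
  move=> /near1; apply: filterS => z vz.
  rewrite Ck_maxE Ck_minE CkN Ck_oneE min_l ?ltW//.
  by rewrite max_r//; lra.
- have /cvgr_lt : v z @[z --> q t] --> v (q t) by exact: Ck_cts.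
  move=> /(_ (-1)) near1; have : v (q t) < -1.
    rewrite vE big1 ?mulr0//; first lra.
    by move=> t' _; have [_ + _] := uP t'; apply; exists t.
  move=> /near1; apply: filterS => z vz.
  rewrite Ck_maxE Ck_minE CkN Ck_oneE min_r; last lra.
  by rewrite max_l// ltW.
Qed.

Section system.
Variable A : set Y.
Hypotheses (tychY : tychonoff_space Y) (A0 : A !=set0)
  (noiso : forall x, ~ isolated A x).

(** The signs are required on a neighbourhood of the point, so that the point may
be moved within [A] when a further function is added. *)
Definition sign_complete (es : seq (Ck R Y)) := forall s : nat -> bool,
  exists2 a, A a & \forall z \near a, forall i, (i < size es)%N ->
    nth 0 es i z = (-1) ^+ s i.

(** Near the point [p t] that realises the pattern [t] there is another point
[q t] of [A], since [p t] is not isolated.  A function equal to [1] near all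
[p t] and to [- 1] near all [q t] doubles the number of patterns. *)
Lemma sign_complete_rcons es : sign_complete es ->
  exists e : Ck R Y, (forall y, `|e y| <= 1) /\ sign_complete (rcons es e).
Proof.
move=> ces; pose n := size es.
pose P (s : nat -> bool) z := forall i, (i < n)%N -> nth 0 es i z = (-1) ^+ s i.
pose T := {ffun 'I_n -> bool}.
pose ext (t : T) i := if insub i is Some j then t j else false.
have /choice[p pP] (t : T) : exists p, A p /\ \forall z \near p, P (ext t) z.
  by have [a Aa ha] := ces (ext t); exists a.
have /choice[q qP] (t : T) : exists q, [/\ A q, q <> p t
    & \forall z \near q, P (ext t) z].
  have [Ap nP] := pP t.
  apply: contrapT => nq; apply: (@noiso (p t)); split; first exact: mem_set.
  exists (interior (P (ext t))); first exact: nbhs_interior.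
  apply/seteqP; split => [x [Px Ax]|x ->]; last by split => //.
  by apply: contrapT => xp; apply: nq; exists x.
have pq t t' : p t <> q t'.
  move=> ptq; have [_ /nbhs_singleton Pp] := pP t.
  have [_ qp /nbhs_singleton Pq] := qP t'.
  apply: qp; rewrite -ptq; congr p; apply/ffunP => i.
  have := Pp i (ltn_ord i); rewrite ptq Pq//.
  by rewrite /ext valK => /signr_inj.
have [e [e1 ep eq]] := finite_separation tychY pq.
exists e; split => // s.
pose t : T := [ffun i : 'I_n => s i].
have Ps z i : P (ext t) z -> (i < n)%N -> nth 0 es i z = (-1) ^+ s i.
  by move=> /(_ i) + ni => /(_ ni) ->; rewrite /ext insubT /= ffunE.
case sn : (s n).
  have [Aq _ nq] := qP t; exists (q t) => //.
  near=> z => i; rewrite size_rcons nth_rcons ltnS leq_eqVlt => /orP[/eqP ->|ni].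
    by rewrite ltnn eqxx -/n sn expr1; near: z; exact: eq.
  by rewrite ni; apply: Ps => //; near: z.
have [Ap np] := pP t; exists (p t) => //.
near=> z => i; rewrite size_rcons nth_rcons ltnS leq_eqVlt => /orP[/eqP ->|ni].
  by rewrite ltnn eqxx -/n sn expr0; near: z; exact: ep.
by rewrite ni; apply: Ps => //; near: z.
Unshelve. all: by end_near. Qed.

Lemma rademacher_system : exists e : nat -> Ck R Y,
  (forall n y, `|e n y| <= 1) /\ forall n (s : nat -> bool),
  exists2 a, A a & forall i, (i < n)%N -> e i a = (-1) ^+ s i.
Proof.
have /choice[F FP] es : exists e : Ck R Y, sign_complete es ->
    (forall y, `|e y| <= 1) /\ sign_complete (rcons es e).
  have [ces|nces] := pselect (sign_complete es); last by exists 0.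
  by have [e ee] := sign_complete_rcons ces; exists e.
pose E n := iter n (fun es => rcons es (F es)) [::].
have cE n : sign_complete (E n).
  elim: n => [s|n /FP[]//]; have [a Aa] := A0; exists a => //.
  by near=> z.
exists (fun n => F (E n)); split => [n|n s]; first by have [] := FP _ (cE n).
have EE : E n = mkseq (fun n => F (E n)) n.
  by elim: n {s} => // n ih; rewrite mkseqS -ih.
have [a Aa /nbhs_singleton ha] := cE n s; exists a => // i ni.
have := ha i; rewrite {1}EE size_mkseq => /(_ ni) <-.
by rewrite EE nth_mkseq.
Unshelve. all: by end_near. Qed.

End system.
End rademacher.

Section rademacher_mean.
Context (R : realType) (Y : topologicalType).

(** Flipping the sign [s i] changes the sign of the sum. *)
Lemma sum_sign_orth (n : nat) (i j : 'I_n) : i != j ->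
  \sum_(s : {ffun 'I_n -> bool}) (-1) ^+ s i * (-1) ^+ s j = 0 :> R.
Proof.
move=> ij; pose flip (s : {ffun 'I_n -> bool}) :=
  [ffun k => if k == i then ~~ s k else s k].
have flipK : involutive flip.
  by move=> s; apply/ffunP => k; rewrite !ffunE; case: eqP => /=; rewrite ?negbK.
set S := LHS.
have SN : S = - S.
  rewrite {1}/S (reindex_inj (inv_inj flipK)) -sumrN.
  apply: eq_bigr => s _; rewrite !ffunE eqxx eq_sym (negbTE ij).
  by rewrite signrN mulNr.
lra.
Qed.

(** [I] is a limit of the averages [S m] over points of [A], one for each pattern
of [m] signs.  For [m > i, j] the average of [e i * e j] is the correlation of
two coordinates on the cube of sign patterns, which is [(i == j)%:R]; the limit
inherits this. *)
Lemma rademacher_mean (A L : set Y) : tychonoff_space Y -> compact L ->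
  A `<=` L -> A !=set0 -> (forall x, ~ isolated A x) ->
  exists (I : continuous_dual (Ck R Y)) (e : nat -> Ck R Y),
  [/\ forall f : Ck R Y, (forall y, L y -> 0 <= f y) -> 0 <= sval I f,
      sval I (Ck_one R Y) = 1,
      forall n y, `|e n y| <= 1
    & forall i j, sval I (Ck_mul (e i) (e j)) = (i == j)%:R].
Proof.
move=> tychY cL AL A0 noiso.
have [e [e1 eA]] := rademacher_system R tychY A0 noiso.
pose T m := {ffun 'I_m -> bool}.
have yP m (s : T m) : {y | A y /\ forall i : 'I_m, e i y = (-1) ^+ s i}.
  apply: cid; pose ext i := if insub i is Some j then s j else false.
  have [a Aa ha] := eA m ext; exists a; split => // i.
  by rewrite ha ?ltn_ord// /ext valK.
pose y m s := sval (yP m s).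
have Ay m s : A (y m s) by have [] := svalP (yP m s).
have ey m s (i : 'I_m) : e i (y m s) = (-1) ^+ s i.
  by have [_ +] := svalP (yP m s); apply.
have cardT m : #|{: T m}|%:R = 2 ^+ m :> R.
  by rewrite card_ffun card_bool card_ord natrX.
pose S m (h : Ck R Y) : R := 2^-1 ^+ m * \sum_(s : T m) (h (y m s) : R).
have linS m a f g : S m (a *: f + g) = a * S m f + S m g.
  rewrite /S mulrCA -mulrDr; congr (_ * _).
  by rewrite mulr_sumr -big_split.
have bS m (h : Ck R Y) (c : R) : (forall y, L y -> `|h y| <= c) -> `|S m h| <= 1 * c.
  move=> hc; rewrite mul1r normrM ger0_norm ?exprn_ge0//.
  rewrite exprVn ler_pdivrMl ?exprn_gt0// -cardT.
  apply: le_trans (ler_norm_sum _ _ _) _.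
  rewrite mulr_natl -[leRHS]sumr_const; apply: ler_sum => s _.
  by apply: hc; exact: AL.
have [I hI] := limit_functional cL linS bS.
have I_eventually h N (a : R) : (forall n, (N <= n)%N -> S n h = a) ->
    sval I h = a.
  move=> ha; apply/eqP; rewrite eq_le; apply/andP; split.
    by apply: (hI h N) => n /ha ->.
  rewrite -lerN2 -raddfN; apply: (hI _ N) => n /ha <-.
  by rewrite /S -mulrN -sumrN.
exists I, e; split => //.
- move=> f f0; rewrite -oppr_le0 -raddfN; apply: (hI _ 0%N) => n _.
  rewrite /S pmulr_rle0 ?exprn_gt0//; apply: sumr_le0 => s _.
  by rewrite CkN oppr_le0; apply: f0; exact: AL.
- apply: (I_eventually _ 0%N) => n _.
  rewrite /S sumr_const -mulr_natr mul1r cardT -exprMn mulVf ?expr1n//.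
- move=> i j; apply: (I_eventually _ (maxn i j).+1) => n.
  rewrite gtn_max => /andP[ni nj]; rewrite /S.
  rewrite (eq_bigr (fun s : T n =>
      (-1) ^+ s (Ordinal ni) * (-1) ^+ s (Ordinal nj))); last first.
    by move=> s _; rewrite -!ey.
  have [ij|ij] := eqVneq i j; last by rewrite sum_sign_orth ?mulr0.
  move: ni; rewrite ij => ni; rewrite (bool_irrelevance ni nj).
  rewrite (eq_bigr (fun=> 1)) => [|s _].
    rewrite sumr_const -mulr_natr mul1r cardT -exprMn mulVf ?expr1n//.
  by rewrite -expr2 sqrr_sign.
Qed.
End rademacher_mean.

(** * Pointwise compactness is sequential *)

Lemma cvg_infty_ge (r : nat -> nat) : (forall k, (k <= r k)%N) ->
  r k @[k --> \oo] --> \oo.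
Proof.
move=> kr A [N _ NA]; exists N => // k /= Nk; apply: NA => /=.
exact: leq_trans (kr k).
Qed.

(** Subsequences are indexed by functions [r] with [k <= r k]: this already makes
[r] tend to infinity, and each [r k] can be chosen independently. *)
Lemma not_cvg0_subsequence (R : realType) (a : nat -> R) :
  ~ (a k @[k --> \oo] --> (0 : R)) ->
  exists (eps : R) (r : nat -> nat),
    [/\ 0 < eps, forall k, (k <= r k)%N & forall k, eps <= `|a (r k)|].
Proof.
move=> na; have [eps eps0 he] : exists2 eps : R, 0 < eps &
    forall N, exists2 n, (N <= n)%N & eps <= `|a n|.
  apply: contrapT => nn; apply: na; apply/cvgr0Pnorm_lt => eps eps0.
  apply: contrapT => near_eps; apply: nn; exists eps => // N.
  apply: contrapT => nN; apply: near_eps; exists N => // n /= Nn.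
  by rewrite ltNge; apply/negP => an; apply: nN; exists n.
have /choice[r rP] N : exists n, (N <= n)%N /\ eps <= `|a n|.
  by have [n Nn an] := he N; exists n.
by exists eps, r; split => // k; have [] := rP k.
Qed.

Lemma cluster_cvg_eq (R : realType) (T : topologicalType) (J : Type)
    (G : set_system J) {FG : Filter G} (a : J -> T) (z : T) (phi : T -> R)
    (l : R) :
  {for z, continuous phi} -> cluster (a j @[j --> G]) z ->
  phi (a j) @[j --> G] --> l -> phi z = l.
Proof.
move=> cphi; rewrite cluster_cvgE => -[H PH [Hz GH]] phil.
apply: (cvg_unique (@norm_hausdorff _ R) (F := phi w @[w --> H])).
  exact: cvg_comp Hz cphi.
by move=> A /phil GA; exact: GH.
Qed.

Lemma near_all_seq (T : Type) (I : eqType) (G : set_system T) {FG : Filter G}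
    (s : seq I) (P : I -> T -> Prop) :
  (forall i, \forall t \near G, P i t) ->
  \forall t \near G, forall i, i \in s -> P i t.
Proof.
move=> GP; elim: s => [|j s ih]; first exact: filterE.
apply: filterS2 (GP j) ih => t Pj Ps i; rewrite inE => /orP[/eqP -> //|].
exact: Ps.
Qed.

Section eberlein.
Context (R : realType) (X Y : topologicalType).
Variables (K : set X) (L : set Y) (F : X -> Ck R Y).
Hypotheses (cK : compact K) (cL : compact L).
Hypothesis F_cts : forall y, continuous (fun x => F x y : R).

Let seq_cluster (T : topologicalType) (C : set T) (a : nat -> T) :
  compact C -> (forall n, C (a n)) ->
  exists2 z, C z & cluster (a n @[n --> \oo]) z.
Proof.
move=> cC Ca.
have PF : ProperFilter (a n @[n --> \oo]) by exact: fmap_proper_filter.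
have [|z [Cz az]] := cC _ PF.
  by apply: (@filterE _ \oo) => n; exact: Ca.
by exists z.
Qed.

(** Total boundedness of the image of [L] under the first [n] functions [h i].  The
finite sets, directed by inclusion, form the filter to which the compactness of
[L] is applied. *)
Lemma finite_net (h : nat -> Ck R Y) (n : nat) (eps : R) : 0 < eps ->
  exists s : seq Y, forall y, L y -> exists2 d, d \in s &
    L d /\ forall i, (i < n)%N -> `|h i y - h i d| < eps.
Proof.
move=> eps0.
pose G : set_system (seq Y) := [set A : set (seq Y) | exists s0 : seq Y,
  forall s : seq Y, {subset s0 <= s} -> A s].
have FG : Filter G.
  split; first by exists [::].
    move=> A B [s sA] [t tB]; exists (s ++ t) => r sub; split.
      by apply: sA => y ys; apply: sub; rewrite mem_cat ys.
    by apply: tB => y yt; apply: sub; rewrite mem_cat yt orbT.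
  by move=> A B AB [s sA]; exists s => r /sA /AB.
pose P (s : seq Y) y := exists2 d, d \in s &
    L d /\ forall i, (i < n)%N -> `|h i y - h i d| < eps.
have nc : near_covering L by apply/compact_near_coveringP.
have [|s0 hs] := nc _ G P FG _; last by exists s0; exact: hs.
move=> y Ly.
exists ([set z | forall i, (i < n)%N -> `|h i z - h i y| < eps],
        [set s : seq Y | y \in s]); last first.
  by move=> [z s] [/= hz ys]; exists y.
split; last by exists [:: y] => s; apply; rewrite mem_seq1.
have : \forall z \near y, forall i, i \in iota 0 n ->
    `|(h i y : R) - h i z| < eps.
  by apply: near_all_seq => i; have /cvgr_dist_lt := @Ck_cts _ _ (h i) y; exact.
by apply: filterS => z hz i ni; rewrite distrC; apply: hz; rewrite mem_iota.
Qed.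

(** Let [D] be a countable set that is dense in [L] for the pseudometrics given by
the functions [F (x i)], and [p] a cluster point of the sequence [x].  Since
[D] is countable, some subsequence satisfies [F (x (r k)) --> F p] on [D].  The
convergence holds on all of [L] because cluster points of the sequence that
agree on [D] agree on [L]: a point [y] of [L] is approximated by points of [D]
that cluster at some [z], and [y] and [z] cannot be told apart by the
[F (x i)], hence neither by the functions at the cluster points. *)
Lemma eberlein (x : nat -> X) : (forall n, K (x n)) ->
  exists (r : nat -> nat) (p : X), [/\ K p, forall k, (k <= r k)%N
    & forall y, L y -> (F (x (r k)) y : R) @[k --> \oo] --> (F p y : R)].
Proof.
move=> Kx.
have /choice[D DP] n := @finite_net (F \o x) n n.+1%:R^-1 (ltac:(by [])).
have agree (p q : X) (r t : nat -> nat) :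
    cluster (x (r k) @[k --> \oo]) p -> cluster (x (t k) @[k --> \oo]) q ->
    (forall n d, d \in D n -> L d -> F p d = F q d) ->
    forall y, L y -> F p y = F q y.
  move=> rp tq Dpq y Ly.
  have /choice[d dP] n : exists d, [/\ d \in D n, L d &
      forall i, (i < n)%N -> `|F (x i) y - F (x i) d| < n.+1%:R^-1].
    by have [d dD [Ld hd]] := DP n y Ly; exists d.
  have [|z Lz dz] := @seq_cluster _ L d cL; first by move=> n; have [] := dP n.
  have xzy i : F (x i) z = F (x i) y.
    apply: (cluster_cvg_eq (phi := fun w => F (x i) w : R) _ dz).
      exact: Ck_cts.
    apply/cvgrPdist_lt => eps eps0; near=> k.
    have [_ _ hk] := dP k; apply: lt_trans (hk i _) _; first by near: k; exists i.+1.
    by near: k; exact: (near_infty_natSinv_lt (PosNum eps0)).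
  have zy (s : X) (v : nat -> nat) : cluster (x (v k) @[k --> \oo]) s ->
      F s z = F s y.
    move=> xs; apply/eqP; rewrite -subr_eq0; apply/eqP.
    apply: (cluster_cvg_eq (phi := fun s => (F s z : R) - F s y) _ xs).
      by apply: cvgB; exact: F_cts.
    rewrite [X in X @ _](_ : _ = cst 0); last first.
      by apply/funext => k; rewrite /= xzy subrr.
    exact: cvg_cst.
  rewrite -(zy _ _ rp) -(zy _ _ tq).
  apply/eqP; rewrite -subr_eq0; apply/eqP.
  apply: (cluster_cvg_eq (phi := fun w => (F p w : R) - F q w) _ dz).
    by apply: cvgB; exact: Ck_cts.
  rewrite [X in X @ _](_ : _ = cst 0); last first.
    apply/funext => k; have [dD Ld _] := dP k.
    by rewrite /= (Dpq _ _ dD Ld) subrr.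
  exact: cvg_cst.
have [p Kp xp] := @seq_cluster _ K x cK Kx.
have /choice[r rP] k : exists n, (k <= n)%N /\
    forall i d, (i < k.+1)%N -> d \in D i -> `|F p d - F (x n) d| < k.+1%:R^-1.
  pose V := [set q | forall i d, (i < k.+1)%N -> d \in D i ->
    `|F p d - F q d| < k.+1%:R^-1].
  have nV : nbhs p V.
    have : \forall q \near p, forall d,
        d \in flatten [seq D i | i <- iota 0 k.+1] ->
        `|(F p d : R) - F q d| < k.+1%:R^-1.
      by apply: near_all_seq => d; have /cvgr_dist_lt := @F_cts d p; exact.
    apply: filterS => q hq i d ik di; apply: hq; apply/flattenP.
    by exists (D i) => //; apply/mapP; exists i; rewrite // mem_iota.
  have [|_ [[n /= kn <-] Vn]] := xp [set x n | n in [set n | (k <= n)%N]] V _ nV.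
    by exists k => // n kn; exists n.
  by exists n.
have rD i d : d \in D i -> (F (x (r k)) d : R) @[k --> \oo] --> (F p d : R).
  move=> di; apply/cvgrPdist_lt => eps eps0; near=> k.
  have [_ /(_ i d)] := rP k; rewrite ltnS => hk.
  apply: lt_trans (hk _ di) _; first by near: k; exists i.
  by near: k; exact: (near_infty_natSinv_lt (PosNum eps0)).
exists r, p; split => // [k|y Ly]; first by have [] := rP k.
apply: contrapT => ncvg.
have /not_cvg0_subsequence[eps [t [eps0 kt ht]]] :
    ~ (((F (x (r k)) y : R) - F p y) @[k --> \oo] --> (0 : R)).
  by move/subr_cvg0.
have [|q Kq xq] := @seq_cluster _ K (fun k => x (r (t k))) cK; first by [].
have Fqp : F q y = F p y.
  apply: (agree q p (r \o t) id) => // i d di _.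
  apply: (cluster_cvg_eq (phi := fun s => F s d : R) _ xq); first exact: F_cts.
  exact: (cvg_comp t _ (cvg_infty_ge kt) (rD i d di)).
have nq : \forall s \near q, `|(F q y : R) - F s y| < eps.
  by have /cvgr_dist_lt := @F_cts y q; exact.
have [|_ [[k _ <-]]] := xq [set x (r (t k)) | k in setT] _ _ nq.
  by exists 0%N => // k _; exists k.
by rewrite /= Fqp distrC ltNge ht.
Unshelve. all: by end_near. Qed.

End eberlein.

(** * Null sequences from a weakly continuous family *)

Lemma Ck_eval_dual (R : realType) (Y : topologicalType) (y : Y) :
  exists phi : continuous_dual (Ck R Y), forall h, sval phi h = h y.
Proof.
have lin_eval : linear (fun h : Ck R Y => h y : R^o) by [].
pose mev := GRing.isLinear.Build R (Ck R Y) R^o *:%R _ lin_eval.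
pose ev : {linear Ck R Y -> R^o} := HB.pack (fun h : Ck R Y => h y : R^o) mev.
have cev : continuous (ev : Ck R Y -> R^o).
  apply: (@dual_of_bound _ _ ev [set y] 1); first exact: compact_set1.
  by move=> h e he; rewrite mul1r; exact: he.
by exists (exist _ ev cev).
Qed.

Section weakly_continuous.
Context (R : realType) (X Y : topologicalType).
Variables (K : set X) (L : set Y) (F : X -> Ck R Y).
Hypotheses (cK : compact K) (cL : compact L).
Hypothesis F_weak : forall phi : continuous_dual (Ck R Y),
  continuous (fun x => sval phi (F x) : R).

Lemma weakly_continuous_eval y : continuous (fun x => F x y : R).
Proof.
have [phi phiE] := Ck_eval_dual R y.
rewrite (_ : (fun _ => _) = (fun x => sval phi (F x) : R)); last first.
  by apply/funext => x; rewrite phiE.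
exact: (@F_weak phi).
Qed.

(** Gliding hump.  If the bound fails, there are [h n] in the family that reach a
huge value [t n] at a point [z n] where [`|h n|] is maximal on [L].  The functional
[psi = sum_n c_n delta_(z n)] has [`|c_n| <= 3 ^- n], where the sign of [c_n] is
chosen so that the [n]-th term does not cancel the previous ones on [h n].  The
later terms contribute at most half of the [n]-th one, so [psi (h n)] is
unbounded, although [psi] is bounded on the weakly compact family. *)
Lemma weakly_compact_bounded :
  exists M : R, forall x y, K x -> L y -> `|F x y| <= M.
Proof.
apply: contrapT => unb.
have large (c : R) : exists xz : X * Y, [/\ K xz.1, L xz.2,
    c < `|F xz.1 xz.2| & forall y, L y -> `|F xz.1 y| <= `|F xz.1 xz.2|].
  apply: contrapT => nc; apply: unb; exists c => x y Kx Ly.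
  rewrite leNgt; apply/negP => cxy; apply: nc.
  have [||z zL zmax] := @compact_EVT_max _ R (Ck_abs (F x)) L _ cL.
  - by exists y.
  - by apply: continuous_subspaceT; exact: Ck_cts.
  exists (x, z); split => //=; first exact: set_mem.
    by apply: lt_le_trans cxy (zmax y _); exact: mem_set.
  by move=> y' Ly'; apply: zmax; exact: mem_set.
(* The factor [2 * 3 ^+ n] offsets the weight [3 ^- n] and the halving. *)
have /choice[xz xzP] n := large (2 * 3 ^+ n * n.+1%:R).
pose h n := F (xz n).1; pose z n := (xz n).2.
pose t n : R := h n (z n).
pose step (s : Ck R Y -> R) n : R :=
  (if 0 <= s (h n) then Num.sg (t n) else - Num.sg (t n)) * 3^-1 ^+ n.
pose S := fix S n : Ck R Y -> R := if n is m.+1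
  then fun g => S m g + step (S m) m * g (z m) else fun=> 0.
have linS n a f g : S n (a *: f + g) = a * S n f + S n g.
  elim: n => [|n ih] /=; first by rewrite mulr0 addr0.
  by rewrite ih CkD CkZ; ring.
have SN n g : S n (- g) = - S n g.
  by elim: n => [|n ih] /=; rewrite ?oppr0// ih CkN mulrN opprD.
have step_le n : `|step (S n) n| <= 3^-1 ^+ n.
  rewrite normrM [X in _ * X]ger0_norm ?exprn_ge0//.
  rewrite ler_piMl ?exprn_ge0//.
  by case: ifP => _; rewrite ?normrN normr_sg; case: eqP.
have S_tail (g : Ck R Y) (c : R) N n : (forall y, L y -> `|g y| <= c) ->
    (N <= n)%N -> `|S n g - S N g| <= c * (3 / 2 * (3^-1 ^+ N - 3^-1 ^+ n)).
  move=> gc; elim: n => [|n ih].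
    by rewrite leqn0 => /eqP ->; rewrite !subrr normr0 !mulr0.
  rewrite leq_eqVlt => /orP[/eqP ->|]; first by rewrite !subrr normr0 !mulr0.
  rewrite ltnS => /ih {}ih /=.
  have Lz : L (z n) by have [] := xzP n.
  have -> : S n g + step (S n) n * g (z n) - S N g =
      (S n g - S N g) + step (S n) n * (g (z n) : R) by rewrite addrAC.
  apply: le_trans (ler_normD _ _) _.
  have : `|step (S n) n * (g (z n) : R)| <= 3^-1 ^+ n * c.
    by rewrite normrM; apply: ler_pM => //; exact: gc.
  by rewrite exprS; move: ih; lra.
have bS n (g : Ck R Y) (c : R) :
    (forall y, L y -> `|g y| <= c) -> `|S n g| <= 3 / 2 * c.
  move=> gc; have := S_tail g c 0%N n gc (leq0n n); rewrite subr0 => /le_trans; apply.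
  have c0 : 0 <= c.
    by apply: le_trans (gc (z 0%N) _); rewrite ?normr_ge0//; have [] := xzP 0%N.
  rewrite mulrCA ler_pM2l ?divr_gt0// ler_piMr// expr0 gerBl exprn_ge0//.
have [psi hpsi] := limit_functional cL linS bS.
have [B B0 hB] := compact_norm_bounded cK (@F_weak psi).
have psi_large n : n.+1%:R <= `|sval psi (h n) : R|.
  have [_ Lz lt_t le_t] := xzP n.
  have half (m : nat) : (n < m)%N ->
      `|S m (h n) - S n.+1 (h n)| <= `|t n| * 3^-1 ^+ n / 2.
    move=> nm; apply: le_trans (S_tail (h n) `|t n| n.+1 m le_t nm) _.
    rewrite -[leRHS]mulrA ler_wpM2l// exprS.
    have : 0 <= 3^-1 ^+ m :> R by rewrite exprn_ge0.
    lra.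
  have big_t : n.+1%:R <= `|t n| * 3^-1 ^+ n / 2.
    rewrite exprVn ler_pdivlMr// ler_pdivlMr ?exprn_gt0//.
    have -> : n.+1%:R * 2 * 3 ^+ n = 2 * 3 ^+ n * n.+1%:R :> R by ring.
    exact: ltW.
  have S_step : S n.+1 (h n) = S n (h n) + step (S n) n * t n by [].
  have [S0|S0] := leP 0 (S n (h n)).
    apply: le_trans (ler_norm _); rewrite -lerN2 -raddfN.
    apply: (hpsi _ n.+1) => m nm.
    rewrite SN lerN2; move: (half m nm).
    rewrite S_step /step S0 mulrAC -normrEsg ler_norml => /andP[]; lra.
  rewrite -normrN; apply: le_trans (ler_norm _); rewrite lerNr.
  apply: (hpsi _ n.+1) => m nm; move: (half m nm).
  rewrite S_step /step (lt_geF S0) mulrAC mulNr -normrEsg ler_norml => /andP[].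
  lra.
have iB : 0 < B^-1 by rewrite invr_gt0.
have [n _ /(_ n (leqnn n))] := near_infty_natSinv_lt (PosNum iB).
rewrite /= ltf_pV2 ?posrE// => /lt_le_trans/(_ (psi_large n)).
by rewrite ltNge hB//; have [] := xzP n.
Qed.

End weakly_continuous.

Section dunford_pettis.
Context (R : realType) (X Y : topologicalType).
Variables (K : set X) (L : set Y) (F : X -> Ck R Y).
Hypotheses (cK : compact K) (cL : compact L).
Hypothesis F_weak : forall phi : continuous_dual (Ck R Y),
  continuous (fun x => sval phi (F x) : R).
Variables (I : {linear Ck R Y -> R^o}) (e : nat -> Ck R Y).
Hypothesis Ipos : forall f : Ck R Y, (forall y, L y -> 0 <= f y) -> 0 <= I f.
Hypothesis I1 : I (Ck_one R Y) = 1.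
Hypothesis e_le1 : forall n y, `|e n y| <= 1.
Hypothesis orth : forall i j, I (Ck_mul (e i) (e j)) = (i == j)%:R.

(** Along a subsequence that stays away from [0], [F (x n)] may be assumed to
converge to [F p] pointwise and boundedly on [L].  Dominated convergence takes
care of [F (x n) - F p], since [`|e n| <= 1], and Bessel's inequality of
[F p]. *)
Lemma orthonormal_weak_cvg0 (x : nat -> X) : (forall n, K (x n)) ->
  I (Ck_mul (e n) (F (x n))) @[n --> \oo] --> (0 : R).
Proof.
move=> Kx; apply: contrapT => /not_cvg0_subsequence[eps [t [eps0 kt ht]]].
have Fy := weakly_continuous_eval F_weak.
have [|r [p [Kp kr cvp]]] := @eberlein _ _ _ K L F cK cL Fy (x \o t).
  by move=> n; exact: Kx.
have [M hM] := weakly_compact_bounded cK cL F_weak.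
pose v k := t (r k).
have kv k : (k <= v k)%N by exact: leq_trans (kr k) (kt _).
pose u k := Ck_abs (F (x (v k)) - F p).
have Iu : I (u k) @[k --> \oo] --> (0 : R).
  apply: (@dominated_cvg0 _ _ L I Ipos I1 u (M + M)) => //.
  - by move=> k y Ly; rewrite Ck_absE normr_ge0.
  - move=> k y Ly; rewrite Ck_absE CkD CkN.
    by apply: le_trans (ler_normB _ _) _; apply: lerD; exact: hM.
  - move=> y Ly; rewrite -(normr0 R).
    apply: (@cvg_norm _ R _ _ _ (fun k => (F (x (v k)) y : R) - F p y)).
    by apply/subr_cvg0; exact: cvp.
have Ie : I (Ck_mul (e (v k)) (F p)) @[k --> \oo] --> (0 : R).
  exact: (cvg_comp v _ (cvg_infty_ge kv) (bessel_cvg0 Ipos (F p) orth)).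
have [k [k1 k2]] : exists k, `|I (u k) : R| < eps / 2 /\
    `|I (Ck_mul (e (v k)) (F p)) : R| < eps / 2.
  have e2 : 0 < eps / 2 by rewrite divr_gt0.
  have Iu_lt : \forall k \near \oo, `|I (u k) : R| < eps / 2.
    exact: cvgr0_norm_lt.
  have Ie_lt : \forall k \near \oo,
      `|I (Ck_mul (e (v k)) (F p)) : R| < eps / 2 by exact: cvgr0_norm_lt.
  by have [k []] := filter_ex (filterI Iu_lt Ie_lt); exists k.
have := ht (r k); rewrite leNgt => /negP; apply.
rewrite -/(v k).
have -> : F (x (v k)) = (F (x (v k)) - F p) + F p by rewrite subrK.
rewrite Ck_mulDr linearD; apply: le_lt_trans (ler_normD _ _) _.
rewrite [ltRHS](splitr eps); apply: ltrD => //.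
apply: le_lt_trans k1; apply: le_trans (positive_abs Ipos _) _.
apply: (@le_trans _ _ (I (u k))); last exact: (ler_norm (I (u k) : R)).
apply: (positive_le Ipos) => y Ly.
rewrite !Ck_absE Ck_mulE normrM ler_piMl//.
Qed.

End dunford_pettis.

(** * Disjoint bumps at points of an infinite set *)

Section disjoint_bumps.
Context (R : realType) (X : topologicalType).
Variable K : set X.
Hypotheses (tychX : tychonoff_space X) (infK : infinite_set K).

(** If [p] has a neighbourhood [V] disjoint from an open [V'] where [K] is still
infinite, a bump inside [V] leaves [V'] free for the following ones. *)
Let bump_in (p : X) (V V' W : set X) : open V -> open W -> V p -> W p -> K p ->
  open V' -> V `&` V' = set0 -> infinite_set (W `&` V' `&` K) ->
  exists (pb : X * Ck R X) (W' : set X), [/\ K pb.1, pb.2 pb.1 = 1,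
    forall z, `|pb.2 z| <= 1, forall z, ~ W z -> pb.2 z = 0
    & [/\ forall z, W' z -> pb.2 z = 0, W' `<=` W, open W' & infinite_set (W' `&` K)]].
Proof.
move=> oV oW Vp Wp Kp oV' VV' infW.
have [||b [bp b0 b1]] := @tychonoff_separation R X p (~` (W `&` V)) tychX.1.
- by apply: open_closedC; exact: openI.
- exact.
exists (p, b), (W `&` V'); split => //=.
- by move=> z; have /andP[b0z b1z] := b1 z; rewrite ger0_norm.
- by move=> z nWz; apply: b0 => -[].
- split => //; last exact: openI.
  move=> z [_ V'z]; apply: b0 => -[_ Vz].
  by have : (V `&` V') z by []; rewrite VV'.
Qed.

(** Separate two points of [W `&` K] by a function [u].  The sets [u < 2/3] and
[1/3 < u] cover [W `&` K], so one of them has infinitely many of its points, and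
the bump goes at the point on the other side. *)
Lemma bump_step (W : set X) : open W -> infinite_set (W `&` K) ->
  exists (pb : X * Ck R X) (W' : set X), [/\ K pb.1, pb.2 pb.1 = 1,
    forall z, `|pb.2 z| <= 1, forall z, ~ W z -> pb.2 z = 0
    & [/\ forall z, W' z -> pb.2 z = 0, W' `<=` W, open W' & infinite_set (W' `&` K)]].
Proof.
move=> oW infW; have [p [Wp Kp]] := infinite_setN0 infW.
have [q [[Wq Kq] qp]] := infinite_setN0 (infinite_setD infW (finite_set1 p)).
have [|pq|u [up uq _]] := @tychonoff_separation R X p [set q] tychX.1.
- by apply: accessible_closed_set1; apply: hausdorff_accessible; exact: tychX.2.
- by apply: qp; rewrite /= pq.
have o_lt c : open [set z | u z < c :> R].
  apply: (@open_comp _ _ u [set r : R | r < c]) => [z _|]; first exact: Ck_cts.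
  exact: open_lt.
have o_gt c : open [set z | c < u z :> R].
  apply: (@open_comp _ _ u [set r : R | c < r]) => [z _|]; first exact: Ck_cts.
  exact: open_gt.
have [infU|finU] := pselect (infinite_set (W `&` [set z | u z < 2 / 3 :> R] `&` K)).
  apply: (@bump_in p [set z | 2 / 3 < u z :> R] [set z | u z < 2 / 3 :> R] W) => //=.
    by rewrite up; lra.
  by apply/seteqP; split => // z [/=]; lra.
apply: (@bump_in q [set z | u z < 1 / 3 :> R] [set z | 1 / 3 < u z :> R] W) => //=.
- by rewrite uq//; lra.
- by apply/seteqP; split => // z [/=]; lra.
move=> finU'; apply: infW; move/contrapT : finU => finU.
have : finite_set ((W `&` [set z | u z < 2 / 3 :> R] `&` K) `|`
    (W `&` [set z | 1 / 3 < u z :> R] `&` K)) by rewrite finite_setU.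
apply: sub_finite_set => z [Wz Kz] /=.
have [uz|uz] := ltP (u z : R) (2 / 3); first by left.
by right; split => //; split => //=; lra.
Qed.

Lemma disjoint_bumps : exists (x : nat -> X) (b : nat -> Ck R X),
  [/\ forall n, K (x n), forall n, b n (x n) = 1,
      forall n z, `|b n z| <= 1
    & forall i j z, i != j -> b i z != 0 -> b j z = 0].
Proof.
have /choice[step stepP] (W : set X) : exists pW : (X * Ck R X) * set X,
    open W -> infinite_set (W `&` K) ->
    let: (pb, W') := pW in [/\ K pb.1, pb.2 pb.1 = 1,
    forall z, `|pb.2 z| <= 1, forall z, ~ W z -> pb.2 z = 0
    & [/\ forall z, W' z -> pb.2 z = 0, W' `<=` W, open W' & infinite_set (W' `&` K)]].
  have [[oW infW]|nW] := pselect (open W /\ infinite_set (W `&` K)).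
    by have [pb [W' ?]] := bump_step oW infW; exists (pb, W').
  have [p _] := infinite_setN0 infK.
  by exists ((p, 0), W) => oW infW; exfalso; apply: nW.
pose W n := iter n (fun W => (step W).2) setT.
have Wok n : open (W n) /\ infinite_set (W n `&` K).
  elim: n => [|n [oW infW]]; first by split; [exact: openT|rewrite setTI].
  by have := stepP _ oW infW; rewrite /=; case: (step _) => pb W' [_ _ _ _ []].
pose x n := (step (W n)).1.1; pose b n := (step (W n)).1.2.
have bP n : [/\ K (x n), b n (x n) = 1, forall z, `|b n z| <= 1,
    forall z, ~ W n z -> b n z = 0
    & (forall z, W n.+1 z -> b n z = 0) /\ W n.+1 `<=` W n].
  have [oW infW] := Wok n; have := stepP _ oW infW; rewrite /x /b /=.
  by case: (step _) => pb W' [? ? ? ? []].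
have Wdecr i j : (i <= j)%N -> W j `<=` W i.
  move=> /subnK <-; elim: (j - i)%N => [//|k ih].
  by apply: subset_trans ih; have [_ _ _ _ []] := bP (k + i)%N.
have disj i j z : (i < j)%N -> b i z = 0 \/ b j z = 0.
  move=> ij; have [Wz|nWz] := pselect (W i.+1 z).
    by left; have [_ _ _ _ [+ _]] := bP i; apply.
  right; have [_ _ _ + _] := bP j; apply.
  by move=> /(Wdecr _ _ ij).
exists x, b; split => [n|n|n z|i j z ij /eqP bi].
- by have [] := bP n.
- by have [] := bP n.
- by have [_ _ + _ _] := bP n; apply.
by move: ij; rewrite neq_ltn => /orP[] /(disj _ _ z) [].
Qed.

End disjoint_bumps.

(** * Complemented copies and the pointwise and weak topologies *)

Lemma closed_equalizer (R : realType) (T U : topologicalType) (f h : T -> U)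
    (J : Type) (ev : J -> U -> R) :
  (forall u v, (forall j, ev j u = ev j v) -> u = v) ->
  (forall j, continuous (ev j)) -> continuous f -> continuous h ->
  closed [set t | f t = h t].
Proof.
move=> sep cev cf ch t; rewrite closureEcluster => ct.
apply: sep => j; apply/eqP; rewrite -subr_eq0; apply/eqP.
pose phi t := ev j (f t) - ev j (h t).
apply: (cluster_cvg_eq (FG := globally_filter _) (a := id) (phi := phi) _ ct).
  apply: (@cvgB _ R _ (nbhs t) _ (ev j \o f) (ev j \o h)).
    by apply: continuous_comp; [exact: cf|exact: cev].
  by apply: continuous_comp; [exact: ch|exact: cev].
move=> A /nbhs_singleton A0; rewrite /globally/= => s /= fh.
by rewrite /phi fh subrr.
Qed.

Lemma complemented_of_retraction (R : realType)
    (F G : preTopologicalLmodType R) (T : {linear F -> G}) (S : {linear G -> F}) :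
  cancel T S -> continuous T -> continuous S ->
  closed [set g | T (S g) = g] -> closed [set g | S g = 0] ->
  contains_complemented_copy G F.
Proof.
move=> TS cT cS closedT closedS.
have rangeE : range T = [set g | T (S g) = g].
  by apply/seteqP; split => [_ [a _ <-]|g <-] /=; [rewrite TS|exists (S g)].
exists (range T), [set g | S g = 0]; split.
- split; last by rewrite rangeE.
  split; first by rewrite inE; exists 0; rewrite ?raddf0.
  move=> a u v /set_mem[u' _ <-] /set_mem[v' _ <-]; rewrite inE.
  by exists (a *: u' + v') => //; rewrite linearP.
- split => //; split; first by rewrite inE /= raddf0.
  move=> a u v /set_mem/= u0 /set_mem/= v0; rewrite inE /=.
  by rewrite linearP u0 v0 scaler0 addr0.
- split.
    move=> g; exists (T (S g)), (g - T (S g)); split; first by exists (S g).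
      by rewrite /= raddfB /= TS subrr.
    by rewrite addrC subrK.
  apply/seteqP; split => [g [[a _ <-] /=]|_ ->].
    by rewrite TS => ->; rewrite raddf0.
  by split; [exists 0; rewrite ?raddf0|rewrite /= raddf0].
- exists T, S; split => //; exact: continuous_subspaceT.
- exists (fun g => T (S g)).
    by move=> _ g2 [a _ <-] /= Sg2; rewrite linearD TS Sg2 addr0.
  by move=> g; apply: continuous_comp; [exact: cS|exact: cT].
Qed.

Section topologies.
Context (R : realType).

Section weak.
Variable E : preTopologicalLmodType R.

Lemma cvg_weak_topology (J : Type) (F : set_system J) (FF : Filter F)
    (u : J -> weak E) (w : weak E) :
  (forall phi : continuous_dual E,
    sval phi (u j) @[j --> F] --> (sval phi w : R^o)) ->
  u j @[j --> F] --> w.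
Proof.
by move=> cu; apply/cvg_sup => phi; apply: cvg_initial_topology; exact: cu.
Qed.

Lemma weak_dual_continuous (phi : continuous_dual E) :
  continuous (sval phi : weak E -> R^o).
Proof.
move=> w A nA; have /cvg_sup/(_ phi) : nbhs w --> (w : weak E) by exact: cvg_id.
apply; exact: (@initial_continuous _ _ (sval phi : E -> R^o) w A nA).
Qed.

End weak.

Lemma cvg_ptws (X : topologicalType) (U : topologicalType) (J : Type)
    (F : set_system J) (FF : Filter F) (u : J -> {ptws X -> U})
    (w : {ptws X -> U}) :
  (forall x, u j x @[j --> F] --> w x) -> u j @[j --> F] --> w.
Proof.
move=> cu; apply/cvg_sup => x.
exact: (@cvg_initial_topology _ _ (fun f : X -> U => f x) _ _ _ _ _ (cu x)).
Qed.

Lemma ptws_eval_continuous (X U : topologicalType) (x : X) :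
  continuous (fun w : {ptws X -> U} => w x).
Proof. exact: (@proj_continuous X (fun=> U) x). Qed.

Section Cp.
Variables (X : topologicalType) (E : topologicalLmodType R).

Lemma cvg_Cp (J : Type) (F : set_system J) (FF : Filter F)
    (u : J -> Cp X E) (g : Cp X E) :
  (forall x, u j x @[j --> F] --> g x) -> u j @[j --> F] --> g.
Proof. by move=> cu; apply: cvg_initial_topology; exact: cvg_ptws. Qed.

Lemma Cp_eval_continuous x : continuous (fun g : Cp X E => g x).
Proof.
move=> g; apply: (@continuous_comp _ _ _
  (fun f : Cp X E => (f : X -> E) : {ptws X -> E}) (fun w => w x)).
  exact: (@initial_continuous _ _
    (fun f : continuousType X E => (f : X -> E) : {ptws X -> E})).
exact: ptws_eval_continuous.
Qed.

End Cp.

Lemma cvg_c0p (J : Type) (F : set_system J) (FF : Filter F)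
    (u : J -> c0p R) (a : c0p R) :
  (forall n, val (u j) n @[j --> F] --> val a n) -> u j @[j --> F] --> a.
Proof.
by move=> cu; apply: cvg_initial_topology; exact: (@cvg_ptws nat R^o).
Qed.

Lemma c0p_eval_continuous n : continuous (fun a : c0p R => val a n : R^o).
Proof.
move=> a; apply: (@continuous_comp _ _ _
  (fun a : c0p R => (val a : {ptws nat -> R^o})) (fun w => w n)).
  exact: (@initial_continuous _ _
    (fun a : c0p R => (val a : {ptws nat -> R^o}))).
exact: (@ptws_eval_continuous nat R^o).
Qed.

End topologies.

(** * The copy of (c_0)_p *)

Section disjoint_series.
Context (R : realType) (X : topologicalType).
Variable b : nat -> Ck R X.
Hypothesis b_le1 : forall n z, `|b n z| <= 1.
Hypothesis b_disj : forall i j z, i != j -> b i z != 0 -> b j z = 0.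

(** The only index whose bump does not vanish at [z].  Where all bumps vanish the
default value does no harm, since [b 0 z = 0] there. *)
Definition bump_index z : nat := xget 0%N [set n | b n z != 0].

Lemma bump_indexE n z : b n z != 0 -> bump_index z = n.
Proof.
move=> bn; have /= := @xgetPex _ 0%N [set n | b n z != 0] (ex_intro _ n bn).
rewrite -/(bump_index z) => bi; apply/eqP; apply: contraT => ni.
by move: bn; rewrite (b_disj ni bi) eqxx.
Qed.

(** The function is [sum_n c n * b n], and its distance to the partial sum of the
first [N] terms is at most [sup_(n >= N) `|c n|]: it is a uniform limit of
continuous functions. *)
Lemma disjoint_series_continuous (c : nat -> R) :
  c n @[n --> \oo] --> (0 : R) ->
  continuous (fun z => c (bump_index z) * (b (bump_index z) z : R)).
Proof.
move=> c0 z0; apply/cvgrPdist_lt => eps eps0.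
have e3 : 0 < eps / 3 by rewrite divr_gt0.
have [N _ hN] : \forall n \near \oo, `|c n| < eps / 3.
  exact: cvgr0_norm_lt.
pose s : Ck R X := \sum_(n < N) c n *: b n.
have sE z : s z = \sum_(n < N) c n * (b n z : R) by rewrite Ck_sumE.
have approx z : `|c (bump_index z) * (b (bump_index z) z : R) - (s z : R)| < eps / 3.
  have zero n : n != bump_index z -> c n * (b n z : R) = 0.
    move=> ni; have [->|/bump_indexE bn] := eqVneq (b n z) 0.
      by rewrite mulr0.
    by rewrite bn eqxx in ni.
  have [lt|ge] := ltnP (bump_index z) N.
    rewrite sE (bigD1 (Ordinal lt))//= big1 ?addr0 ?subrr ?normr0//.
    by move=> i ni; apply: zero.
  rewrite sE big1 ?subr0 => [|i _]; last first.
    by apply: zero; rewrite neq_ltn (leq_trans (ltn_ord i) ge).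
  rewrite normrM; apply: le_lt_trans (hN _ ge).
  by rewrite ler_piMr//; exact: b_le1.
have near_s : \forall z \near z0, `|(s z0 : R) - s z| < eps / 3.
  by have /cvgr_dist_lt := @Ck_cts R X s z0; exact.
apply: filterS near_s => z hz.
have := approx z0; have := approx z; move: hz.
rewrite !ltr_norml => /andP[? ?] /andP[? ?] /andP[? ?]; apply/andP; split; lra.
Qed.

End disjoint_series.

Section copy.
Context (R : realType) (X Y : topologicalType).
Let E : topologicalLmodType R := weak (Ck R Y).
Variables (K : set X) (L : set Y) (x : nat -> X) (b : nat -> Ck R X).
Variables (I : {linear Ck R Y -> R^o}) (e : nat -> Ck R Y).
Hypotheses (cK : compact K) (cL : compact L) (Kx : forall n, K (x n)).
Hypothesis b1 : forall n, b n (x n) = 1.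
Hypothesis b_le1 : forall n z, `|b n z| <= 1.
Hypothesis b_disj : forall i j z, i != j -> b i z != 0 -> b j z = 0.
Hypothesis Ipos : forall f : Ck R Y, (forall y, L y -> 0 <= f y) -> 0 <= I f.
Hypothesis I1 : I (Ck_one R Y) = 1.
Hypothesis e_le1 : forall n y, `|e n y| <= 1.
Hypothesis orth : forall i j, I (Ck_mul (e i) (e j)) = (i == j)%:R.

Lemma c0p_cvg (a : c0p R) : (val a n : R) @[n --> \oo] --> (0 : R).
Proof. by have /asboolP := valP a. Qed.

(** [a n *: e n] tends to [0] uniformly, hence in [Ck R Y]. *)
Lemma dual_null (a : c0p R) (phi : continuous_dual (Ck R Y)) :
  (val a n : R) * (sval phi (e n) : R) @[n --> \oo] --> (0 : R).
Proof.
have ae : (val a n *: e n : Ck R Y) @[n --> \oo] --> (0 : Ck R Y).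
  apply: Ck_cvg => D cD eps eps0.
  have an : \forall n \near \oo, `|val a n : R| < eps.
    by apply: cvgr0_norm_lt => //; exact: c0p_cvg.
  apply: filterS an => n an y _.
  rewrite CkZ Ck0 sub0r normrN normrM; apply: le_lt_trans an.
  by rewrite ler_piMr.
have := cvg_comp _ _ ae (svalP phi 0); rewrite raddf0 => cphi.
rewrite (_ : (fun _ => _) = (fun n => sval phi (val a n *: e n)))//.
by apply/funext => n; rewrite linearZ_LR.
Qed.

(** This is [sum_n a n * b n z *: e n], reduced to its only nonzero term.  The index
of that term does not depend on [a], which makes linearity in [a] and
continuity in [a] immediate. *)
Definition embed_fun (a : c0p R) (z : X) : E :=
  ((val a (bump_index b z) : R) * (b (bump_index b z) z : R)) *:
    e (bump_index b z).

Lemma embed_continuous (a : c0p R) : continuous (embed_fun a).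
Proof.
move=> z; apply: cvg_weak_topology => phi.
have c0 := dual_null a phi.
have := @disjoint_series_continuous R X b b_le1 b_disj _ c0 z.
rewrite (_ : (fun z => _) = (fun z => sval phi (embed_fun a z)))//.
by apply/funext => w; rewrite /embed_fun linearZ_LR mulrAC.
Qed.

Definition embed (a : c0p R) : Cp X E := mkcts (@embed_continuous a).

Lemma embed_linear : linear embed.
Proof.
move=> k a a'; apply/continuousEP => z.
rewrite /= /mkcts /embed_fun.
by rewrite -[RHS]/(k *: embed_fun a z + embed_fun a' z) /embed_fun scalerA
  -scalerDl mulrA mulrDl.
Qed.

HB.instance Definition _ :=
  GRing.isLinear.Build R (c0p R) (Cp X E) *:%R embed embed_linear.

Lemma embed_eval a n : embed a (x n) = val a n *: e n :> Ck R Y.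
Proof.
have xn : bump_index b (x n) = n.
  by apply: (bump_indexE b_disj); rewrite b1 oner_neq0.
by rewrite /embed /= /mkcts /embed_fun xn b1 mulr1.
Qed.

Lemma coef_linear n : linear (fun h : Ck R Y => I (Ck_mul (e n) h) : R^o).
Proof. by move=> k f g; rewrite Ck_mulDr Ck_mulZr linearP. Qed.

Definition coef n : Ck R Y -> R^o := fun h => I (Ck_mul (e n) h).

HB.instance Definition _ n :=
  GRing.isLinear.Build R (Ck R Y) R^o *:%R (coef n) (@coef_linear n).

Lemma coef_continuous n : continuous (coef n : Ck R Y -> R^o).
Proof.
apply: (@dual_of_bound R Y (coef n) L 1) => // h c hc; rewrite mul1r.
apply: le_trans (positive_abs Ipos _) _.
apply: (positive_le_cst Ipos I1) => y Ly; rewrite Ck_absE Ck_mulE normrM.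
by apply: le_trans (hc y Ly); rewrite ler_piMl.
Qed.

Definition coef_dual n : continuous_dual (Ck R Y) :=
  exist _ (coef n : {linear _ -> _}) (@coef_continuous n).

Lemma project_in_c0 (g : Cp X E) : (fun n => coef n (g (x n))) \in @c0_pred R.
Proof.
apply/asboolP.
apply: (@orthonormal_weak_cvg0 R X Y K L (fun z => g z)) => // phi z.
apply: (@continuous_comp _ _ _ (g : X -> E)); first exact: cts_fun.
exact: weak_dual_continuous.
Qed.

Definition project (g : Cp X E) : c0p R :=
  @exist (nat -> R^o) (fun a => a \in @c0_pred R) (fun n => coef n (g (x n)))
    (project_in_c0 g).

Lemma project_linear : linear project.
Proof.
move=> k f g; apply/val_inj/funext => n /=.
exact: (coef_linear n k (f (x n)) (g (x n))).
Qed.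

HB.instance Definition _ :=
  GRing.isLinear.Build R (Cp X E) (c0p R) *:%R project project_linear.

Lemma embedK : cancel embed project.
Proof.
move=> a; apply/val_inj/funext => n /=.
rewrite embed_eval /coef Ck_mulZr linearZ_LR orth eqxx.
exact: mulr1.
Qed.

Lemma embed_cts : continuous (embed : c0p R -> Cp X E).
Proof.
move=> a; have Fa := @nbhs_filter (c0p R) a.
apply: cvg_Cp => z; apply: cvg_weak_topology => phi.
pose n := bump_index b z; pose k : R := (b n z : R) * (sval phi (e n) : R).
have phiE (a' : c0p R) : sval phi (embed a' z) = (val a' n : R) * k.
  by rewrite /= /mkcts /embed_fun linearZ_LR /k mulrA.
rewrite phiE (_ : (fun a' => _) = (fun a' : c0p R => (val a' n : R) * k)).
  by apply: cvgMr_tmp; exact: c0p_eval_continuous.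
by apply/funext => a'; exact: phiE.
Qed.

Lemma project_cts : continuous (project : Cp X E -> c0p R).
Proof.
move=> g; have Fg := @nbhs_filter (Cp X E) g.
apply: cvg_c0p => n /=.
apply: (@continuous_comp _ _ _ (fun g : Cp X E => g (x n)) (coef n : E -> R^o)).
  exact: Cp_eval_continuous.
exact: (@weak_dual_continuous _ _ (coef_dual n)).
Qed.

Lemma contains_complemented_c0p : contains_complemented_copy (Cp X E) (c0p R).
Proof.
apply: (@complemented_of_retraction R _ _ embed project).
- exact: embedK.
- exact: embed_cts.
- exact: project_cts.
- pose ev (zy : X * Y) (g : Cp X E) : R := (g zy.1 : Ck R Y) zy.2.
  apply: (@closed_equalizer R (Cp X E) (Cp X E) _ id _ ev).
  + move=> f g fg; apply/continuousEP => z; apply: CkP => y.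
    exact: (fg (z, y)).
  + move=> [z y]; have [phi phiE] := Ck_eval_dual R y.
    rewrite (_ : ev _ = (fun g : Cp X E => sval phi (g z) : R)); last first.
      by apply/funext => g; rewrite phiE.
    move=> g; apply: (@continuous_comp _ _ _ (fun g : Cp X E => g z)).
      exact: Cp_eval_continuous.
    exact: weak_dual_continuous.
  + move=> g; apply: (@continuous_comp _ _ _ project embed).
      exact: project_cts.
    exact: embed_cts.
  + by move=> g; exact: cvg_id.
- pose ev n (a : c0p R) : R := val a n.
  have := @closed_equalizer R (Cp X E) (c0p R) project (fun=> 0) _ ev; apply.
  + by move=> u v uv; apply/val_inj/funext.
  + by move=> n; exact: c0p_eval_continuous.
  + exact: project_cts.
  + exact: cst_continuous.
Qed.

End copy.

Theorem corollary7p3 (R : realType) (X Y : topologicalType)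
  (tychX : tychonoff_space X)
  (infX : exists K : set X, compact K /\ infinite_set K)
  (tychY : tychonoff_space Y)
  (infY : infinite_set [set: Y])
  (nscY : exists L : set Y, compact L /\ ~ scattered L) :
  contains_complemented_copy (Cp X (weak (Ck R Y))) (c0p R).
Proof.
have [K [cK infK]] := infX.
have [L [cL /existsNP[A /not_implyP[AL /not_implyP[A0 noiso]]]]] := nscY.
have {}noiso y : ~ isolated A y by move=> yA; apply: noiso; exists y.
have [I [e [Ipos I1 e1 orth]]] := rademacher_mean R tychY cL AL A0 noiso.
have [x [b [Kx bx b1 b_disj]]] := disjoint_bumps R tychX infK.
exact: (contains_complemented_c0p cK cL Kx bx b1 b_disj Ipos I1 e1 orth).
Qed.
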